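(* Let $q$ be a prime power and $k\ge 1$ an integer. Then $$\mathcal{L}_q(k)=\frac{q^k-1}{q-1}+1,$$ where $\mathcal{L}_q(k)$ denotes the maximum, over all linear codes $C$ of dimension $k$ over $\mathbb{F}_q$ (of arbitrary length $n$), of the number of distinct values taken by the Hamming weight $\mathrm{wt}(c)$ as $c$ ranges over $C$ (the weight $0$ of the zero codeword included).
   Context: A linear $[n,k]_q$ code is a $k$-dimensional subspace of $\mathbb{F}_q^n$; the Hamming weight of a vector is its number of non-zero coordinates. The count of distinct weights includes the zero weight. *)

(* Defs.v *)
From HB Require Import structures.
From mathcomp Require Import all_boot all_order all_algebra all_field.
Set Implicit Arguments.
Unset Strict Implicit.
Unset Printing Implicit Defensive.
Import GRing.Theory.
Local Open Scope nat_scope.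

Definition hamming_weight (F : finFieldType) (n : nat) (c : 'rV[F]_n) : nat :=
  #|[set i : 'I_n | c ord0 i != 0%R]|.

(* The zero codeword belongs to C, so the weight 0 is always counted. *)
Definition num_weights (F : finFieldType) (n : nat) (C : {vspace 'rV[F]_n}) :
    nat :=
  size (undup [seq hamming_weight c | c : 'rV[F]_n in C]).

(* [is_max_num_weights F k m] says that the maximum L_q(k), with q = #|F|,
   exists and equals m; the length n ranges over all naturals, so a priori
   the maximum is taken over an infinite family of codes. *)
Definition is_max_num_weights (F : finFieldType) (k m : nat) : Prop :=
  (exists (n : nat) (C : {vspace 'rV[F]_n}), \dim C = k /\ num_weights C = m)
  /\ (forall (n : nat) (C : {vspace 'rV[F]_n}),
        \dim C = k -> num_weights C <= m).

(* Main.v *)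
Require Import Defs.
From HB Require Import structures.
From mathcomp Require Import all_boot all_order all_algebra all_field.
Local Open Scope nat_scope.

(** Proportional codewords have equal weight, so a weight class of non-zero
    codewords has at least [q - 1] elements; this gives the upper bound.  It is
    attained by the code whose coordinates are the linear forms [u |-> u . v],
    for [v] in [F^k], the form of [v] being repeated [2 ^ rank v] times: the
    weight of [u] is then a binary encoding of [{v | u . v <> 0}], and this set
    determines [u] up to a scalar factor. *)

Set Implicit Arguments.
Unset Strict Implicit.
Unset Printing Implicit Defensive.
Import GRing.Theory.

(** Parity recovers the digit at [0]; removing it and halving leaves the sum of the shifted digits,
    to which induction applies. *)
Lemma binary_sum_inj (n : nat) (P Q : 'I_n -> bool) :
  \sum_(i < n) P i * 2 ^ i = \sum_(i < n) Q i * 2 ^ i -> P =1 Q.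
Proof.
elim: n P Q => [|n IHn] P Q; first by move=> _ [].
have step (S : 'I_n.+1 -> bool) : \sum_(i < n.+1) S i * 2 ^ i
    = S ord0 + (\sum_(i < n) S (lift ord0 i) * 2 ^ i).*2.
  rewrite big_ord_recl muln1 -mul2n big_distrr /=; congr (_ + _).
  by apply: eq_bigr => i _; rewrite /bump add1n expnS mulnCA.
rewrite !step => eqPQ.
have eq0 : P ord0 = Q ord0.
  by have := congr1 odd eqPQ; rewrite !oddD !odd_double !addbF !oddb.
move: eqPQ; rewrite eq0 => /addnI /double_inj /IHn eqPQ i.
by case: (unliftP ord0 i) => [j|] ->.
Qed.

Lemma binary_weight_inj (T : finType) (P Q : pred T) :
  \sum_(x | P x) 2 ^ enum_rank x = \sum_(x | Q x) 2 ^ enum_rank x -> P =1 Q.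
Proof.
have toord (S : pred T) : \sum_(x | S x) 2 ^ enum_rank x
    = \sum_(i < #|T|) S (enum_val i) * 2 ^ i.
  rewrite big_mkcond (reindex _ (onW_bij _ (@enum_val_bij T))) /=.
  by apply: eq_bigr => i _; rewrite enum_valK; case: (S _); rewrite ?mul1n.
rewrite !toord => /binary_sum_inj eqPQ x.
by have := eqPQ (enum_rank x); rewrite enum_rankK.
Qed.

(** Trades a count on lists for the cardinal of a set; the values are bounded so that the codomain
    is finite. *)
Lemma size_undup_image (T : finType) (A : {pred T}) (n : nat)
    (f : T -> 'I_n) :
  size (undup [seq val (f x) | x in A]) = #|f @: A|.
Proof.
rewrite /image_mem map_comp undup_map_inj; last exact: val_inj.
rewrite size_map -(card_uniqP (undup_uniq _)); apply: eq_card => y.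
rewrite mem_undup; apply/imageP/imsetP => -[x Ax ->]; by exists x.
Qed.

Section Weights.

Variables (F : finFieldType) (n : nat).
Implicit Types (c : 'rV[F]_n) (C : {vspace 'rV[F]_n}).

Lemma hamming_weight_lt c : hamming_weight c < n.+1.
Proof. by rewrite ltnS -[n in _ <= n]card_ord max_card. Qed.

Lemma hamming_weight_eq0 c : (hamming_weight c == 0) = (c == 0%R).
Proof.
rewrite cards_eq0; apply/eqP/eqP => [/setP c0|->]; last first.
  by apply/setP => i; rewrite !inE mxE eqxx.
by apply/rowP => i; have := c0 i; rewrite !inE mxE => /negbFE /eqP.
Qed.

Lemma hamming_weightZ (a : F) c :
  (a != 0)%R -> hamming_weight (a *: c)%R = hamming_weight c.
Proof.
move=> a0; apply: eq_card => i.
by rewrite !inE mxE mulf_eq0 negb_or a0.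
Qed.

(** Weights as elements of a finite type, so that words can be partitioned by weight. *)
Definition weight_ord c : 'I_n.+1 := Ordinal (hamming_weight_lt c).

Lemma weight_ord_inj c c' :
  weight_ord c = weight_ord c' -> hamming_weight c = hamming_weight c'.
Proof. by move=> /(congr1 val). Qed.

Definition nonzero_words C : {set 'rV[F]_n} := [set c in C | c != 0%R].

Lemma card_nonzero_words C : #|nonzero_words C| = #|F| ^ \dim C - 1.
Proof.
rewrite -card_vspace [#|C|](cardD1 0%R) mem0v add1n subn1 /=.
by apply: eq_card => c; rewrite !inE andbC.
Qed.

(** Only the zero word has weight 0, so it adds exactly one weight to those of the non-zero
    words. *)
Lemma num_weightsE C :
  num_weights C = #|weight_ord @: nonzero_words C| + 1.
Proof.
rewrite /num_weights (size_undup_image _ weight_ord).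
have -> : weight_ord @: C = weight_ord 0%R |: weight_ord @: nonzero_words C.
  apply/setP => w; rewrite in_setU1; apply/imsetP/orP => [[c cC ->]|[/eqP ->|]].
  - have [->|c0] := eqVneq c 0%R; first by left.
    by right; apply: imset_f; rewrite inE cC.
  - by exists 0%R; rewrite ?mem0v.
  - by case/imsetP => c /[!inE] /andP[cC _] ->; exists c.
rewrite cardsU1 addnC; congr (_ + _).
case: imsetP => // -[c /[!inE] /andP[_ c0]] /weight_ord_inj /esym/eqP.
have /eqP -> : hamming_weight (0%R : 'rV[F]_n) == 0.
  by rewrite hamming_weight_eq0.
by rewrite hamming_weight_eq0 (negPf c0).
Qed.

Lemma card_nonzero_scalars : #|predC1 (0%R : F)| = #|F| - 1.
Proof. by rewrite cardC1 subn1. Qed.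

Lemma sum_weight_classes C :
  #|F| ^ \dim C - 1
  = \sum_(w in weight_ord @: nonzero_words C)
      #|[set c in nonzero_words C | weight_ord c == w]|.
Proof.
rewrite -card_nonzero_words -sum1_card (partition_big_imset weight_ord) /=.
by apply: eq_bigr => w _; rewrite -sum1dep_card.
Qed.

Lemma num_weights_le C :
  num_weights C <= (#|F| ^ \dim C - 1) %/ (#|F| - 1) + 1.
Proof.
have q1 : 0 < #|F| - 1 by rewrite subn_gt0 finNzRing_gt1.
rewrite num_weightsE leq_add2r leq_divRL // sum_weight_classes -sum_nat_const.
apply: leq_sum => _ /imsetP[c /[!inE] /andP[cC c0] ->].
rewrite -card_nonzero_scalars.
(* Since [c] is non-zero, [a |-> a *: c] is injective: the class of [c] contains [#|F| - 1] distinct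
   multiples. *)
rewrite -(card_in_imset (f := fun a : F => (a *: c)%R)); last first.
  move=> a b _ _ /eqP; rewrite -subr_eq0 -scalerBl scaler_eq0 (negPf c0) orbF.
  by rewrite subr_eq0 => /eqP.
apply/subset_leq_card/subsetP => _ /imsetP[a /[!inE] a0 ->].
rewrite memvZ // scaler_eq0 (negPf a0) c0 /=.
by apply/eqP/val_inj/hamming_weightZ.
Qed.

(** If equal weight forces proportionality, a weight class consists of non-zero multiples of any one
    of its members, so it has at most [#|F| - 1] elements. *)
Lemma num_weights_ge C :
    {in C &, forall c c', hamming_weight c = hamming_weight c' ->
       exists a : F, c' = (a *: c)%R} ->
  (#|F| ^ \dim C - 1) %/ (#|F| - 1) + 1 <= num_weights C.
Proof.
move=> propC; have q1 : 0 < #|F| - 1 by rewrite subn_gt0 finNzRing_gt1.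
rewrite num_weightsE leq_add2r sum_weight_classes.
(* Writing the number of classes as a quotient by [#|F| - 1] leaves a comparison of numerators, done
   class by class. *)
rewrite -[X in _ <= X](mulnK _ q1) leq_div2r // -sum_nat_const.
apply: leq_sum => _ /imsetP[c /[!inE] /andP[cC c0] ->].
rewrite -card_nonzero_scalars.
apply: leq_trans (leq_imset_card (fun a : F => (a *: c)%R) _).
apply/subset_leq_card/subsetP => c' /[!inE] /andP[/andP[c'C c'0]].
move=> /eqP/weight_ord_inj/esym/(propC _ _ cC c'C)[a c'E].
apply/imsetP; exists a => //; rewrite inE.
by apply: contraNneq c'0 => a0; rewrite c'E a0 scale0r.
Qed.

End Weights.

(** The columns of [cokermx u] are killed by [u], hence by [w]; so [w] lies in the row space of [u],
    which is the line spanned by [u]. *)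
Lemma same_zeros_scale (F : fieldType) (k : nat) (u w : 'rV[F]_k) :
    (forall v : 'cV[F]_k, ((u *m v)%R == 0%R) = ((w *m v)%R == 0%R)) ->
  exists a : F, w = (a *: u)%R.
Proof.
move=> same0.
have /submxP[D ->] : (w <= u)%MS.
  rewrite submxE; apply/eqP/matrixP => i j.
  have /eqP/matrixP/(_ i 0%R) : (w *m col j (cokermx u) == 0)%R.
    by rewrite -same0 colE mulmxA mulmx_coker mul0mx.
  by rewrite colE mulmxA -colE !mxE.
by exists (D 0 0)%R; rewrite {1}[D]mx11_scalar mul_scalar_mx.
Qed.

Section BinaryCode.

Variables (F : finFieldType) (k : nat).

(** A pair of [v] and [j] stands for the [j]-th copy of the form of [v]. *)
Definition coord_index : finType := {v : 'cV[F]_k & 'I_(2 ^ enum_rank v)}.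

Definition coord_form (i : 'I_#|coord_index|) : 'cV[F]_k :=
  tag (enum_val i : {v : 'cV[F]_k & 'I_(2 ^ enum_rank v)}).

Definition binary_gen : 'M[F]_(k, #|coord_index|) :=
  \matrix_(j, i) coord_form i j 0%R.

Definition binary_code : {vspace 'rV[F]_#|coord_index|} :=
  limg (linfun (mulmxr binary_gen : 'rV[F]_k -> _)).

Lemma mul_binary_gen (u : 'rV[F]_k) (i : 'I_#|coord_index|) :
  ((u *m binary_gen) ord0 i = (u *m coord_form i) 0 0)%R.
Proof. by rewrite !mxE; apply: eq_bigr => j _; rewrite !mxE. Qed.

Lemma hamming_weight_binary_gen (u : 'rV[F]_k) :
  hamming_weight (u *m binary_gen)%R
  = \sum_(v : 'cV[F]_k | (u *m v)%R != 0%R) 2 ^ enum_rank v.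
Proof.
rewrite /hamming_weight -sum1dep_card.
under eq_bigl => i do rewrite mul_binary_gen.
rewrite -(reindex enum_val (P := fun t : coord_index =>
  ((u *m tag t) 0 0 != 0)%R) (F := fun=> 1)) /=; last exact/onW_bij/enum_val_bij.
(* Each power of two is spread over its copies, so that [sig_big_dep] merges the double sum into a
   sum over pairs. *)
rewrite (eq_bigr (fun v : 'cV[F]_k => \sum_(j < 2 ^ enum_rank v) 1)); last first.
  by move=> v _; rewrite sum1_card card_ord.
rewrite sig_big_dep /=; apply: eq_bigl => t; rewrite andbT.
congr (~~ _); apply/eqP/eqP => [e|->]; last by rewrite mxE.
by apply/matrixP => a b; rewrite !ord1 e mxE.
Qed.

Lemma binary_gen_weight_inj (u w : 'rV[F]_k) :
    hamming_weight (u *m binary_gen)%R = hamming_weight (w *m binary_gen)%R ->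
  exists a : F, w = (a *: u)%R.
Proof.
rewrite !hamming_weight_binary_gen => /binary_weight_inj same.
by apply: same_zeros_scale => v; apply/negb_inj/same.
Qed.

(** A vector in the kernel has an image of the same weight as that of the zero vector, so it is a
    multiple of zero. *)
Lemma binary_gen_inj (u : 'rV[F]_k) : (u *m binary_gen = 0 -> u = 0)%R.
Proof.
move=> u0.
have [a ->] : exists a : F, u = (a *: (0 : 'rV[F]_k))%R.
  by apply: binary_gen_weight_inj; rewrite u0 mul0mx.
by rewrite scaler0.
Qed.

Lemma dim_binary_code : \dim binary_code = k.
Proof.
rewrite limg_dim_eq; first by rewrite dimvf dim_matrix; apply: mul1n.
apply/eqP; rewrite -subv0; apply/subvP => u.
rewrite memv_cap memvf memv_ker lfunE memv0 /= => /eqP u0.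
exact/eqP/binary_gen_inj.
Qed.

Lemma num_weights_binary_code :
  num_weights binary_code = (#|F| ^ k - 1) %/ (#|F| - 1) + 1.
Proof.
rewrite -[in RHS]dim_binary_code; apply/eqP; rewrite eqn_leq num_weights_le /=.
apply: num_weights_ge => _ _ /memv_imgP[u _ ->] /memv_imgP[w _ ->].
rewrite !lfunE /= => /binary_gen_weight_inj[a ->].
by exists a; rewrite scalemxAl.
Qed.

End BinaryCode.

Theorem theorem1 (q k : nat) (F : finFieldType) (hq : #|F| = q) (hk : 1 <= k) :
  is_max_num_weights F k ((q ^ k - 1) %/ (q - 1) + 1).
Proof.
rewrite -hq; split=> [|n C <-]; last exact: num_weights_le.
(* The length is the number of all copies, the sum of [2 ^ enum_rank v] over all [v]. *)
exists #|coord_index F k|, (binary_code F k).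
by split; [apply: dim_binary_code | apply: num_weights_binary_code].
Qed.
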